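(* Let $G=(V,E)$ be a finite graph, and let $V=V_1\sqcup V_2$ be a decomposition of its vertex set into disjoint sets such that: (1) every vertex $v\in V_1$ has an even degree; (2) after decomposing the induced subgraph $G[V_2]$ into its connected components $G[V_2^{(1)}],\ldots,G[V_2^{(m)}]$, each $V_2^{(i)}$ satisfies $4\mid\sum_{v\in V_2^{(i)}}d_v$. Then there exists a mixed Eulerian-even orientation of $G$ with respect to $(V_1,V_2)$. Moreover, the total number of such orientations is equal to $$ \left(\prod_{v\in V_1}\frac{\binom{d_v}{d_v/2}}{2^{d_v/2}}\right)\cdot 2^{\frac12\sum_{v\in V_2}d_v-|V_2|}\cdot\sum_{F\in\mathcal B(V_1,V_2)}\ \prod_{v\in V_1}\frac{\binom{d_v/2}{d_F(v)/2}}{\binom{d_v}{d_F(v)}}, $$ which is bounded from below by $$ \left(\prod_{v\in V_1}\frac{\binom{d_v}{d_v/2}}{2^{d_v/2}}\right)\cdot 2^{\frac12\sum_{v\in V_2}d_v-|V_2|}. $$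
   Context: An orientation of a graph $G=(V,E)$ is an assignment of a direction to each edge. For $v\in V$, $d_v$ denotes the degree of $v$ in $G$ (also when $v\in V_2$: the degree is taken in $G$, not in $G[V_2]$), and for $F\subseteq E$, $d_F(v)$ denotes the degree of $v$ in the subgraph $(V,F)$. For $V=V_1\sqcup V_2$ with every vertex of $V_1$ of even degree, a mixed Eulerian-even orientation with respect to $(V_1,V_2)$ is an orientation of $G$ in which every vertex $v\in V_1$ has equal in-degree and out-degree, and every vertex in $V_2$ has even out-degree. $\mathcal B(V_1,V_2)$ denotes the collection of all $F\subseteq E$ such that (i) for any $v\in V_1$, $d_F(v)$ is even; and (ii) for any $v\in V_2$, $d_F(v)$ is $0$ or $d_v$.
   Formalization: The counting equality is stated only when no vertex of V_2 is isolated; for a single isolated vertex in V_2 the printed formula gives 1/2 while there is exactly one orientation. Existence and the lower bounds are kept in full. *)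

(* Defs.v *)
From HB Require Import structures.
From mathcomp Require Import all_boot all_order all_algebra.

Set Implicit Arguments.
Unset Strict Implicit.
Unset Printing Implicit Defensive.

(* A finite undirected graph; parallel edges and loops are allowed.  The order
   of the pair [ends e] is only a reference: the notions below do not depend on
   it, up to relabelling orientations. *)
Record graph := Graph {
  vertex : finType;
  edge : finType;
  ends : edge -> vertex * vertex
}.

Section Graph.

Variable G : graph.

Implicit Types (u v : vertex G) (e : edge G) (F : {set edge G}).
Implicit Types A : {set vertex G}.

(* A loop contributes 2 to the degree of its vertex. *)
Definition deg_in F v : nat :=
  \sum_(e in F) (((ends e).1 == v) + ((ends e).2 == v)).

Definition deg v : nat := deg_in [set: edge G] v.

Definition adjacent u v : bool :=
  [exists e : edge G, (ends e == (u, v)) || (ends e == (v, u))].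

Definition induced_adjacent A : rel (vertex G) :=
  [rel u v | [&& u \in A, v \in A & adjacent u v]].

Definition components A : {set {set vertex G}} :=
  equivalence_partition (connect (induced_adjacent A)) A.

(* [o e] tells whether [e] is directed against its reference order; in
   particular a loop has two orientations, one for each of its half-edges. *)
Definition orientation := {ffun edge G -> bool}.

Definition tail (o : orientation) e : vertex G :=
  if o e then (ends e).2 else (ends e).1.

Definition head (o : orientation) e : vertex G :=
  if o e then (ends e).1 else (ends e).2.

Definition outdeg (o : orientation) v : nat := #|[set e | tail o e == v]|.

Definition indeg (o : orientation) v : nat := #|[set e | head o e == v]|.

Definition mixed_Eulerian_even (V1 V2 : {set vertex G}) (o : orientation) : bool :=
  [forall v in V1, indeg o v == outdeg o v] &&
  [forall v in V2, ~~ odd (outdeg o v)].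

Definition calB (V1 V2 : {set vertex G}) : {set {set edge G}} :=
  [set F : {set edge G} |
     [forall v in V1, ~~ odd (deg_in F v)] &&
     [forall v in V2, (deg_in F v == 0) || (deg_in F v == deg v)]].

Local Open Scope ring_scope.

(* The exponent of 2 can be negative (e.g. when a component of G is a tree with
   all its vertices in V2), so it is an integer; the halving is exact as soon
   as the degrees over V2 have an even sum. *)
Definition prefactor (V1 V2 : {set vertex G}) : rat :=
  (\prod_(v in V1) ('C(deg v, (deg v)./2)%:R / 2 ^+ (deg v)./2)) *
  2 ^ ((\sum_(v in V2) deg v)%N./2%:Z - #|V2|%:Z).

Definition edge_subset_sum (V1 V2 : {set vertex G}) : rat :=
  \sum_(F in calB V1 V2) \prod_(v in V1)
    ('C((deg v)./2, (deg_in F v)./2)%:R / 'C(deg v, deg_in F v)%:R).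

End Graph.

(* Main.v *)
Require Import Defs.
From HB Require Import structures.
From mathcomp Require Import all_boot all_order all_algebra.
From mathcomp Require Import ring zify.

(** The count is a Fourier expansion over half-edges.  Give each half-edge the
    sign -1 if it is the tail of its edge and +1 otherwise.  A sign pattern is an
    orientation exactly when the two halves of every edge have opposite signs, and
    expanding the indicator prod_e (1 - s s') / 2 of this condition gives a sum over
    edge sets F of characters of the half-edges of F ([sum_orientation]).  The
    conditions at the vertices concern disjoint sets of half-edges, so for each F
    the sum over all sign patterns factors into local sums, one for each vertex
    ([sum_fibers], [card_mixedE]).

    At a vertex of V2 the local sum is that of a character over the even subsets
    of the star; it vanishes unless F contains none or all of the half-edges there,
    and is then 2^(d - 1) ([sum_even_subset_sign]).  At a vertex of V1 it is the
    middle coefficient of (1 - X)^k (1 + X)^(d - k) with k = d_F(v); this is 0 for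
    odd k, and otherwise (-1)^(k/2) times a super-Catalan number, which is the ratio
    of binomials in the formula ([sum_half_subset_sign]).  So exactly the F in calB
    contribute.

    It remains to see that all contributions are positive.  The vertices of V2 all
    of whose edges lie in F form a union of components of G[V2], so the sum of d_F
    over V2 is divisible by 4 ([four_dvd_sum_deg_in]).  Counting the
    half-edges of F, the sign (-1)^|F| is then the product of the signs
    (-1)^(d_F(v)/2) over V1, and everything cancels ([prod_local_sum]).  The empty F
    contributes 1 and the other terms are nonnegative, which gives the lower bound,
    and existence since the prefactor is positive.

    An isolated vertex of V2 is both empty and full, so its local sum is 1 rather
    than 1/2; [card_mixed] records the resulting power of 2, which is at least 1
    and disappears when no vertex of V2 is isolated. *)

Set Implicit Arguments.
Unset Strict Implicit.
Unset Printing Implicit Defensive.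
Import Order.TTheory GRing.Theory Num.Theory.
Local Open Scope ring_scope.

(** * Signed sums over subsets *)

Lemma sum_subset_prod (R : comNzRingType) (H : finType) (D : {set H}) (a : H -> R) :
  \sum_(B : {set H} | B \subset D) \prod_(h in B) a h = \prod_(h in D) (1 + a h).
Proof.
rewrite [RHS]big_mkcond /=.
transitivity (\prod_h ((if h \in D then a h else 0) + 1)); last first.
  by apply: eq_bigr => h _; case: ifP => _; rewrite ?add0r // addrC.
rewrite bigA_distr [LHS]big_mkcond /=; apply: eq_bigr => B _.
case: ifPn => [/subsetP sBD | /subsetPn [h hB hD]].
  rewrite big_mkcond /=; apply: eq_bigr => h _.
  by case: ifP => // /sBD ->.
by rewrite (bigD1 h) //= hB (negPf hD) mul0r.
Qed.

(** The common source of both local computations: [x := 1] and [x := -1] detect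
    the parity of [B], and [x := 'X] detects its size. *)
Lemma sum_subset_sign (R : comNzRingType) (H : finType) (D T : {set H}) (x : R) :
  T \subset D ->
  \sum_(B : {set H} | B \subset D) x ^+ #|B| * (-1) ^+ #|B :&: T|
    = (1 - x) ^+ #|T| * (1 + x) ^+ (#|D| - #|T|).
Proof.
move=> sTD.
pose a h := if h \in T then - x else x.
transitivity (\sum_(B : {set H} | B \subset D) \prod_(h in B) a h).
  apply: eq_bigr => B _; rewrite (big_setID T) /=.
  rewrite (eq_bigr (fun=> - x)); last by move=> h /setIP [_ hT]; rewrite /a hT.
  rewrite (eq_bigr (fun=> x) (P := fun h => h \in B :\: T)); last first.
    by move=> h /setDP [_ hT]; rewrite /a (negPf hT).
  by rewrite !prodr_const -[in LHS](cardsID T B) exprD [(- x) ^+ _]exprNn; ring.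
rewrite sum_subset_prod (big_setID T) /= (setIidPr sTD).
rewrite (eq_bigr (fun=> 1 - x)); last by move=> h hT; rewrite /a hT.
rewrite (eq_bigr (fun=> 1 + x) (P := fun h => h \in D :\: T)); last first.
  by move=> h /setDP [_ hT]; rewrite /a (negPf hT).
by rewrite !prodr_const cardsD (setIidPr sTD).
Qed.

(** Restricting a set to the fibers of [p] is a bijection onto the families of
    subsets of the fibers.  With [p] the endpoint map of half-edges, this is what
    makes the count factor over the vertices. *)
Lemma sum_fibers (R : comNzRingType) (H V : finType) (p : H -> V)
    (f : V -> {set H} -> R) :
  \sum_(A : {set H}) \prod_v f v (A :&: p @^-1: [set v])
    = \prod_v \sum_(B : {set H} | B \subset p @^-1: [set v]) f v B.
Proof.
rewrite (bigA_distr_big_dep (fun v => [pred B : {set H} | B \subset p @^-1: [set v]])).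
rewrite (reindex_onto (fun A : {set H} => [ffun v => A :&: p @^-1: [set v]])
  (fun g : {ffun V -> {set H}} => [set h | h \in g (p h)])) /=; last first.
  move=> g /familyP sg; apply/ffunP => v; rewrite ffunE; apply/setP => h.
  rewrite !inE; have [<-|nv] := eqVneq (p h) v; rewrite ?andbT ?andbF //.
  apply/esym/negbTE/negP => hg; have /subsetP/(_ h hg) := sg v.
  by rewrite !inE (negPf nv).
apply: eq_big => [A|A _]; last by apply: eq_bigr => v _; rewrite ffunE.
apply/esym/andP; split; first by apply/familyP => v; rewrite ffunE inE subsetIr.
by apply/eqP/setP => h; rewrite !inE ffunE !inE eqxx andbT.
Qed.

(** Vertices with an even number of tails: averaging over [x = 1] and [x = -1]
    keeps the even [B], and the two averages vanish unless [T] is empty,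
    respectively all of [D]. *)
Lemma sum_even_subset_sign (F : numFieldType) (H : finType) (D T : {set H}) :
  T \subset D ->
  \sum_(B : {set H} | B \subset D) (~~ odd #|B|)%:R * (-1) ^+ #|B :&: T|
    = ((#|T| == 0%N)%:R + (#|T| == #|D|)%:R) * 2 ^+ #|D| / 2 :> F.
Proof.
move=> sTD.
have leTD := subset_leq_card sTD.
transitivity ((\sum_(B : {set H} | B \subset D) 1 ^+ #|B| * (-1) ^+ #|B :&: T|
   + \sum_(B : {set H} | B \subset D) (-1) ^+ #|B| * (-1) ^+ #|B :&: T|) / 2 :> F).
  rewrite -big_split /= mulr_suml; apply: eq_bigr => B _.
  rewrite expr1n -signr_odd -[in RHS](signr_odd _ #|B|).
  by case: (odd #|B|) => /=; field.
rewrite !sum_subset_sign // opprK subrr; congr (_ / _).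
have -> : (#|T| == #|D|)%N = (#|D| - #|T| == 0)%N.
  by rewrite subn_eq0 eqn_leq leTD.
rewrite !expr0n [(1 + 1) ^+ _ * _]mulrC mulrDl; congr (_ + _).
  by case: eqP => [->|_]; rewrite ?subn0 ?mul0r.
case: eqP => [e|_]; rewrite ?mul0r //.
by rewrite -{1}(subnKC leTD) e addn0.
Qed.

Lemma coef_1DXn (R : comNzRingType) (n k : nat) :
  ((1 + 'X) ^+ n : {poly R})`_k = 'C(n, k)%:R.
Proof.
elim: n k => [|n IHn] k; first by rewrite expr0 coef1 bin0n.
rewrite exprS mulrDl mul1r coefD coefXM !IHn.
by case: k => [|k] /=; rewrite ?bin0 ?addr0 // binS natrD.
Qed.

(** Up to sign these are the super-Catalan numbers
    S(j, a) = (2j)! (2a)! / (j! a! (j + a)!).  Writing (1 - X)^2 as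
    (1 + X)^2 - 4X gives the recurrence S(j + 1, a) = 4 S(j, a) - S(j, a + 1),
    which drives the induction. *)
Lemma coef_super_Catalan (F : numFieldType) (j a : nat) :
  ((1 - 'X) ^+ j.*2 * (1 + 'X) ^+ a.*2 : {poly F})`_(j + a)
    = (-1) ^+ j * (j.*2`!%:R * a.*2`!%:R / (j`!%:R * a`!%:R * (j + a)`!%:R)).
Proof.
have nz n : (n`!%:R : F) != 0 by rewrite pnatr_eq0 -lt0n fact_gt0.
have nzS n : (n%:R + 1 : F) != 0 by rewrite natr1 pnatr_eq0.
elim: j a => [|j IHj] a.
  rewrite double0 expr0 !mul1r coef_1DXn add0n.
  have le : (a <= a.*2)%N by rewrite -addnn leq_addr.
  have -> : a.*2`!%:R = ('C(a.*2, a))%:R * (a`!%:R * a`!%:R) :> F.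
    by rewrite -(bin_fact le) !natrM -addnn addnK.
  by field; rewrite nz.
rewrite doubleS addSn.
have -> : (1 - 'X) ^+ j.*2.+2 * (1 + 'X) ^+ a.*2 =
    (1 - 'X) ^+ j.*2 * (1 + 'X) ^+ a.+1.*2
      - 4 *: ('X * ((1 - 'X) ^+ j.*2 * (1 + 'X) ^+ a.*2)) :> {poly F}.
  rewrite doubleS [(1 - _) ^+ j.*2.+2]exprS [(1 - _) ^+ j.*2.+1]exprS.
  rewrite [(1 + _) ^+ a.*2.+2]exprS [(1 + _) ^+ a.*2.+1]exprS scaler_nat.
  by ring.
rewrite coefB coefZ coefXM /= IHj.
have := IHj a.+1; rewrite addnS => ->.
rewrite doubleS !factS !natrM exprS -!muln2.
rewrite -!natr1 !natrM natrD.
by field; rewrite !nz !nzS -natrD nzS.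
Qed.

(** Balanced vertices.  For odd [T] the complement in [D] pairs terms of opposite
    sign; for even [T] the sum is the middle coefficient of
    (1 - X)^|T| (1 + X)^(|D| - |T|), a super-Catalan number, here written with the
    binomials of the counting formula. *)
Lemma sum_half_subset_sign (F : numFieldType) (H : finType) (D T : {set H}) :
  T \subset D -> ~~ odd #|D| ->
  \sum_(B : {set H} | B \subset D)
      (#|B| == #|D|./2)%:R * (-1) ^+ #|B :&: T|
    = (~~ odd #|T|)%:R * ((-1) ^+ #|T|./2 *
        ('C(#|D|, #|D|./2)%:R * ('C(#|D|./2, #|T|./2)%:R / 'C(#|D|, #|T|)%:R)))
    :> F.
Proof.
move=> sTD evD; set S := LHS.
have leTD := subset_leq_card sTD.
have [oddT|evT] := boolP (odd #|T|); rewrite /= ?mul0r ?mul1r.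
  (* Over a numeric field, a sum equal to its opposite is 0. *)
  apply/eqP; rewrite -eqNr /S -sumrN; apply/eqP.
  rewrite [RHS](reindex_onto (fun B => D :\: B) (fun B => D :\: B)) /=; last first.
    by move=> B sBD; rewrite setDDr setDv set0U; apply/setIidPr.
  apply: eq_big => [B | B sBD].
    rewrite subsetDl setDDr setDv set0U /=.
    by apply/idP/eqP => [/setIidPr //|<-]; rewrite subsetIl.
  have sBDc := subset_leq_card sBD.
  rewrite cardsD (setIidPr sBD) -mulrN; congr (_ * _).
    by congr (nat_of_bool _)%:R; apply/eqP/eqP; lia.
  have -> : (D :\: B) :&: T = T :\: B.
    by rewrite setIDAC (setIidPr sTD).
  have e := cardsID B T; rewrite [T :&: B]setIC in e.
  have -> : (-1) ^+ #|T :\: B| = (-1) ^+ #|T| * (-1) ^+ #|B :&: T| :> F.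
    by rewrite -[in RHS]e exprD mulrAC -expr2 sqrr_sign mul1r.
  by rewrite -(signr_odd _ #|T|) oddT mulN1r.
(* [j] and [a] count pairs inside and outside [T], so the middle is [j + a]. *)
pose j := #|T|./2; pose a := (#|D| - #|T|)./2.
have eT : #|T| = j.*2 by rewrite /j; lia.
have eDT : (#|D| - #|T| = a.*2)%N by rewrite /a; lia.
have eD2 : #|D|./2 = (j + a)%N by rewrite /j /a; lia.
have eD : #|D| = (j + a).*2 by lia.
transitivity ((\sum_(B : {set H} | B \subset D)
     'X ^+ #|B| * (-1) ^+ #|B :&: T| : {poly F})`_(j + a)).
  rewrite coef_sum; apply: eq_bigr => B _.
  by rewrite -(rmorph_sign polyC) coefMC coefXn eD2 eq_sym.
rewrite sum_subset_sign // eT in eDT *; rewrite eDT coef_super_Catalan.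
rewrite eD2 eD doubleK; congr (_ * _).
have nz n : (n`!%:R : F) != 0 by rewrite pnatr_eq0 -lt0n fact_gt0.
have binE n k l : n = (k + l)%N -> 'C(n, k)%:R = n`!%:R / (k`!%:R * l`!%:R) :> F.
  move=> ->; have := bin_fact (leq_addr l k); rewrite addKn => <-.
  by rewrite !natrM mulfK // mulf_neq0 ?nz.
rewrite (binE _ (j + a)%N (j + a)%N) ?addnn // (binE _ j a) //.
rewrite (binE _ j.*2 a.*2) ?doubleD //.
by field; rewrite !nz.
Qed.

(** * Half-edges and orientations *)

Section HalfEdges.

Variable G : graph.
Implicit Types (v : vertex G) (F : {set edge G}) (o : orientation G).

(** The flag [b] of a half-edge [(e, b)] is the value of an orientation at [e] that
    makes it the tail half. *)
Definition half_edge : finType := (edge G * bool)%type.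

Definition endpoint (h : half_edge) : vertex G :=
  if h.2 then (ends h.1).2 else (ends h.1).1.

Definition star v : {set half_edge} := endpoint @^-1: [set v].

Definition halves F : {set half_edge} := setX F [set: bool].

Definition tails o : {set half_edge} := [set h | o h.1 == h.2].

Lemma big_half_edge (R : Type) (idx : R) (op : Monoid.com_law idx) (P : pred (edge G))
    (f : half_edge -> R) :
  \big[op/idx]_(h | P h.1) f h = \big[op/idx]_(e | P e) op (f (e, false)) (f (e, true)).
Proof.
rewrite (eq_bigl (fun h : half_edge => P h.1 && true)) => [|h]; last by rewrite andbT.
rewrite (eq_bigr (fun h : half_edge => f (h.1, h.2))) => [|[] //].
rewrite -(pair_big_dep P (fun _ => xpredT) (fun e b => f (e, b))).
by apply: eq_bigr => e _; rewrite big_bool Monoid.mulmC.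
Qed.

Lemma deg_inE F v : deg_in F v = #|halves F :&: star v|.
Proof.
rewrite -sum1_card big_mkcond /= /deg_in.
transitivity (\sum_(h : half_edge | h.1 \in F) (endpoint h == v))%N.
  by rewrite big_half_edge.
rewrite big_mkcond /=; apply: eq_bigr => h _.
by rewrite !inE andbT; case: ifP; case: eqP.
Qed.

Lemma degE v : deg v = #|star v|.
Proof.
by rewrite /deg deg_inE; congr #|pred_of_set _|; apply/setP => h; rewrite !inE.
Qed.

Lemma outdegE o v : outdeg o v = #|tails o :&: star v|.
Proof.
rewrite /outdeg -!sum1_card big_mkcond [RHS]big_mkcond /=.
rewrite [RHS](big_half_edge _ xpredT); apply: eq_bigr => e _.
rewrite !inE /tail /endpoint /=.
by case: (o e); case: (_.1 == v); case: (_.2 == v).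
Qed.

Lemma indegE o v : indeg o v = #|star v :\: tails o|.
Proof.
rewrite /indeg -!sum1_card big_mkcond [RHS]big_mkcond /=.
rewrite [RHS](big_half_edge _ xpredT); apply: eq_bigr => e _.
rewrite !inE /Defs.head /endpoint /=.
by case: (o e); case: (_.1 == v); case: (_.2 == v).
Qed.

Lemma sum_deg_in F : (\sum_v deg_in F v = #|F|.*2)%N.
Proof.
rewrite exchange_big /= -muln2 -sum_nat_const; apply: eq_bigr => e _.
rewrite big_split /= (bigD1 (ends e).1) //= eqxx big1 => [|v nv].
  rewrite (bigD1 (ends e).2) //= eqxx big1 // => v nv.
  by rewrite eq_sym (negPf nv).
by rewrite eq_sym (negPf nv).
Qed.

(** A set of half-edges is the set of tails of an orientation exactly when the
    signs of the two halves of each edge are opposite, which has indicator function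
    prod_e (1 - s(e, false) s(e, true)) / 2.  Expanding this product gives the
    sum over [F]. *)
Lemma sum_orientation (R : numFieldType) (g : {set half_edge} -> R) :
  \sum_o g (tails o) = 2 ^- #|edge G| *
    \sum_(F : {set edge G}) (-1) ^+ #|F| *
       \sum_(A : {set half_edge}) (-1) ^+ #|A :&: halves F| * g A.
Proof.
pose sgn (A : {set half_edge}) h : R := (-1) ^+ (h \in A).
pose is_or (A : {set half_edge}) := [forall e, ((e, false) \in A) != ((e, true) \in A)].
transitivity (\sum_(A | is_or A) g A).
  rewrite [RHS](reindex_onto tails (fun A => [ffun e => (e, true) \in A])) /=.
    apply: eq_bigl => o; apply/esym/andP; split.
      by apply/forallP => e; rewrite !inE /=; case: (o e).
    by apply/eqP/ffunP => e; rewrite ffunE !inE /=; case: (o e).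
  move=> A /forallP orA; apply/setP => -[e b]; rewrite !inE ffunE /=.
  by have := orA e; case: b; do 2!case: (_ \in A).
under [X in _ * X]eq_bigr do rewrite mulr_sumr.
rewrite exchange_big /= mulr_sumr big_mkcond /=; apply: eq_bigr => A _.
under eq_bigr do rewrite mulrA.
rewrite -mulr_suml mulrA.
(* The normalized sum over [F] is the expanded indicator of [is_or A]. *)
suff -> : 2 ^- #|edge G| *
    (\sum_(F : {set edge G}) (-1) ^+ #|F| * (-1) ^+ #|A :&: halves F|)
    = (is_or A)%:R :> R.
  by case: ifP => _; rewrite ?mul1r ?mul0r.
transitivity (2 ^- #|edge G| *
    \prod_e (1 + - (sgn A (e, false) * sgn A (e, true)))).
  congr (_ * _).
  rewrite -(eq_bigl _ _ (in_setT (T := edge G))) -sum_subset_prod.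
  apply: eq_big => [F|F _]; first by rewrite subsetT.
  rewrite prodrN; congr (_ * _).
  rewrite -(big_half_edge _ (fun e => e \in F) (sgn A)) -prodr_const.
  rewrite big_mkcond [RHS]big_mkcond /=; apply: eq_bigr => h _.
  by rewrite !inE andbT andbC /sgn; case: (_ \in F); case: (_ \in A).
(* Each factor is 2 if the two halves have opposite signs and 0 otherwise. *)
rewrite /is_or; case: forallP => [orA|/forallP/forallPn [e /negPn/eqP nor]].
  rewrite (eq_bigr (fun=> 2)) ?prodr_const ?mulVf ?expf_neq0 ?pnatr_eq0 //.
  move=> e _; have := orA e; rewrite /sgn.
  by case: (_ \in A); case: (_ \in A) => //= _; rewrite ?mulr1 ?mul1r opprK.
by rewrite (bigD1 e) //= /sgn nor -expr2 sqrr_sign subrr mul0r mulr0.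
Qed.

End HalfEdges.

(** * Components of the induced subgraph *)

(** This is how fullness spreads along the edges inside [V2]: a full vertex has
    all its edges in [F]. *)
Lemma deg_in_adjacent (G : graph) (F : {set edge G}) (u v : vertex G) :
  adjacent u v -> deg_in F u = deg u -> deg_in F v != 0%N.
Proof.
move=> /existsP [e adj_e]; rewrite deg_inE degE => full_u.
have /eqP/setIidPr sub : halves F :&: star u == star u.
  by rewrite eqEcard subsetIr full_u leqnn.
suff [b hv] : exists b, (e, b) \in halves F :&: star v.
  by rewrite deg_inE -lt0n; apply/card_gt0P; exists (e, b).
(* The two halves of an edge joining [u] and [v] lie in the two stars. *)
suff [b [hu hv]] : exists b, (e, ~~ b) \in star u /\ (e, b) \in star v.
  exists b; rewrite inE hv andbT.
  have : (e, ~~ b) \in halves F by apply: (subsetP sub).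
  by rewrite !inE.
case/orP: adj_e => /eqP adj_e; [exists true|exists false];
  by rewrite !inE /endpoint /= adj_e !eqxx.
Qed.

Lemma components_partition (G : graph) (A : {set vertex G}) :
  partition (components A) A.
Proof.
apply: equivalence_partitionP => u v w _ _ _.
have sym : connect_sym (induced_adjacent A).
  apply: sym_connect_sym => x y; rewrite /induced_adjacent /= andbCA.
  by congr (_ && (_ && _)); apply: eq_existsb => e; rewrite orbC.
split=> [|uv]; first exact: connect0.
exact: same_connect sym _ _ uv _.
Qed.

(** Whether [deg_in F v] is zero does not change along an edge inside [V2], so it
    is the same for all vertices of a component. *)
Lemma deg_in_component (G : graph) (V1 V2 : {set vertex G}) F C :
  F \in calB V1 V2 -> C \in components V2 ->
  (\sum_(v in C) deg_in F v = 0)%N \/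
  (\sum_(v in C) deg_in F v = \sum_(v in C) deg v)%N.
Proof.
rewrite inE => /andP [_ /forall_inP fullF] /imsetP [x xV2 ->] {C}.
set C := [set _ in _ | _].
have same v : v \in C -> (deg_in F v == 0%N) = (deg_in F x == 0%N).
  rewrite inE => /andP [_ xv].
  have := @closed_connect _ (induced_adjacent V2) [pred u | deg_in F u == 0%N] _ x v xv.
  rewrite !inE => -> // y z /and3P [yV zV adj]; rewrite !inE.
  have adj' : adjacent z y.
    by move: adj => /existsP [e]; rewrite orbC => ?; apply/existsP; exists e.
  apply/idP/idP; apply: contraLR => nz.
    have := fullF _ zV; rewrite (negPf nz) => /eqP; exact: deg_in_adjacent.
  have := fullF _ yV; rewrite (negPf nz) => /eqP; exact: deg_in_adjacent.
have [x0|x0] := eqVneq (deg_in F x) 0%N; [left|right].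
  by rewrite big1 // => v /same; rewrite x0 => /eqP.
apply: eq_bigr => v vC; have := same _ vC; rewrite (negPf x0) => nz.
by move: vC (fullF v); rewrite inE nz => /andP [vV2 _] /(_ vV2) /eqP.
Qed.

(** The full vertices of [V2] are a union of components, whose degree sums are
    divisible by 4.  This is what cancels the signs of the expansion. *)
Lemma four_dvd_sum_deg_in (G : graph) (V1 V2 : {set vertex G}) F :
  (forall C, C \in components V2 -> (4 %| \sum_(v in C) deg v)%N) ->
  F \in calB V1 V2 -> (4 %| \sum_(v in V2) deg_in F v)%N.
Proof.
move=> V2_comp FB; have /and3P [/eqP cov triv _] := components_partition V2.
rewrite -{1}cov big_trivIset //=; apply: dvdn_sum => C CV2.
by have [->|->] := deg_in_component FB CV2; rewrite ?dvdn0 ?V2_comp.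
Qed.

(** * Local sums and the count *)

Section Count.

Variables (G : graph) (V1 V2 : {set vertex G}).
Hypothesis V12_cover : V1 :|: V2 = [set: vertex G].
Hypothesis V12_disjoint : [disjoint V1 & V2].
Hypothesis V1_even : forall v, v \in V1 -> ~~ odd (deg v).

Lemma in_V2 v : (v \in V2) = (v \notin V1).
Proof.
have : v \in V1 :|: V2 by rewrite V12_cover inE.
rewrite inE => /orP [vV1|vV2]; first by rewrite vV1 (disjointFr V12_disjoint).
by rewrite vV2 (disjointFl V12_disjoint).
Qed.

Lemma big_V12 (R : Type) (idx : R) (op : Monoid.com_law idx) (f : vertex G -> R) :
  \big[op/idx]_v f v = op (\big[op/idx]_(v in V1) f v) (\big[op/idx]_(v in V2) f v).
Proof.
rewrite (bigID (mem V1)) /=; congr (op _ _).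
by apply: eq_bigl => v; rewrite in_V2.
Qed.

Definition admissible (v : vertex G) (B : {set half_edge G}) : bool :=
  if v \in V1 then #|B| == #|star v|./2 else ~~ odd #|B|.

Lemma mixed_admissible (o : orientation G) :
  mixed_Eulerian_even V1 V2 o = [forall v, admissible v (tails o :&: star v)].
Proof.
rewrite /admissible; apply/andP/forallP => [[/forall_inP E1 /forall_inP E2] v | E].
  case: ifPn => [vV1|]; last by rewrite -in_V2 -outdegE; apply: E2.
  have := E1 v vV1; have := cardsID (tails o) (star v).
  by rewrite -indegE outdegE [star v :&: _]setIC; lia.
split; apply/forall_inP => v vV.
  have := E v; have := cardsID (tails o) (star v); have := V1_even vV.
  by rewrite degE vV -indegE outdegE [star v :&: _]setIC; lia.
by have := E v; rewrite outdegE; move: vV; rewrite in_V2 => /negPf ->.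
Qed.

(** The value of the sum of the character of [F] over the admissible subsets of the
    star of [v], for [v] in [V1] of even degree or [v] in [V2]. *)
Definition local_sum F v : rat :=
  if v \in V1 then
    (~~ odd (deg_in F v))%:R * ((-1) ^+ (deg_in F v)./2 *
      ('C(deg v, (deg v)./2)%:R *
        ('C((deg v)./2, (deg_in F v)./2)%:R / 'C(deg v, deg_in F v)%:R)))
  else
    ((deg_in F v == 0%N)%:R + (deg_in F v == deg v)%:R) * 2 ^+ deg v / 2.

(** The signed expansion, before any sign is resolved: the sum over tail sets
    splits into one sum over the subsets of each star. *)
Lemma card_mixedE :
  #|[set o : orientation G | mixed_Eulerian_even V1 V2 o]|%:R =
  2 ^- #|edge G| * \sum_(F : {set edge G}) (-1) ^+ #|F| * \prod_v local_sum F v.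
Proof.
pose g (A : {set half_edge G}) : rat := \prod_v (admissible v (A :&: star v))%:R.
transitivity (\sum_(o : orientation G) g (tails o)).
  rewrite -sum1_card natr_sum big_mkcond /=; apply: eq_bigr => o _.
  rewrite inE mixed_admissible /g; case: forallP => [E|/forallP/forallPn [v /negPf nE]].
    by rewrite big1 // => v _; rewrite E.
  by rewrite (bigD1 v) //= nE mul0r.
rewrite sum_orientation; congr (_ * _); apply: eq_bigr => F _; congr (_ * _).
pose f v (B : {set half_edge G}) : rat :=
  (admissible v B)%:R * (-1) ^+ #|B :&: (halves F :&: star v)|.
transitivity (\sum_(A : {set half_edge G}) \prod_v f v (A :&: star v)).
  apply: eq_bigr => A _; rewrite /f big_split /= mulrC; congr (_ * _).
  rewrite prodrXr; congr (_ ^+ _).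
  rewrite -sum1_card (partition_big (@endpoint G) xpredT) //=.
  apply: eq_bigr => v _; rewrite -sum1_card; apply: eq_bigl => h.
  by rewrite !inE; case: (h \in A); case: (_ == v); rewrite ?andbF ?andbT.
rewrite sum_fibers; apply: eq_bigr => v _; rewrite /f /admissible /local_sum.
rewrite deg_inE degE; case: ifPn => vV1.
  by rewrite sum_half_subset_sign ?subsetIr // -degE V1_even.
by rewrite sum_even_subset_sign ?subsetIr.
Qed.

(** The factor 2^-|E| is distributed over the vertices by the handshake lemma;
    half of the degree sum over [V2] survives, since the local sums there are
    2^(deg v - 1). *)
Lemma prefactorE :
  prefactor V1 V2 = 2 ^- #|edge G| *
    ((\prod_(v in V1) 'C(deg v, (deg v)./2)%:R) * \prod_(v in V2) (2 ^+ deg v / 2)).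
Proof.
rewrite /prefactor !prodf_div !prodrXr prodr_const.
set c := \prod_(v in V1) _; set d1 := (\sum_(v in V1) (deg v)./2)%N.
set d2 := (\sum_(v in V2) deg v)%N.
have ed : (#|edge G|.*2 = d1.*2 + d2)%N.
  rewrite -cardsT -sum_deg_in big_V12 /=; congr (_ + _)%N.
  rewrite -mul2n big_distrr; apply: eq_bigr => v vV1 /=.
  by rewrite mul2n even_halfK ?V1_even.
have [-> ed2] : #|edge G| = (d1 + d2./2)%N /\ d2 = (d2./2 + d2./2)%N by lia.
rewrite expfzDr // -exprnN -exprnP [in RHS](_ : 2 ^+ d2 = 2 ^+ d2./2 * 2 ^+ d2./2);
  last by rewrite -exprD -ed2.
by rewrite exprD; field; rewrite !expf_neq0.
Qed.

Lemma prod_local_sum_eq0 F : F \notin calB V1 V2 -> \prod_v local_sum F v = 0.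
Proof.
rewrite inE negb_and => FnB.
suff [v wv] : exists v, local_sum F v = 0 by rewrite (bigD1 v) //= wv mul0r.
case/orP: FnB => /forall_inPn [v vV wv]; exists v; rewrite /local_sum.
  by rewrite vV; move: wv => /negPf ->; rewrite mul0r.
have := vV; rewrite in_V2 => /negPf ->.
by move: wv; rewrite negb_or => /andP [/negPf -> /negPf ->]; rewrite addr0 !mul0r.
Qed.

Hypothesis V2_comp : forall C, C \in components V2 -> (4 %| \sum_(v in C) deg v)%N.

(** Counting the half-edges of [F] at [V1] and at [V2] shows that |F| has the
    parity of the sum of [(deg_in F v)./2] over [V1], because the part at [V2] is
    divisible by 4; hence the signs cancel.  An isolated vertex of [V2] has
    local sum 1 instead of 2^(0 - 1), which accounts for the power of 2. *)
Lemma prod_local_sum F : F \in calB V1 V2 ->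
  (-1) ^+ #|F| * \prod_v local_sum F v =
  (\prod_(v in V1) 'C(deg v, (deg v)./2)%:R) * (\prod_(v in V2) (2 ^+ deg v / 2)) *
  2 ^+ #|[set v in V2 | deg v == 0%N]| *
  \prod_(v in V1) ('C((deg v)./2, (deg_in F v)./2)%:R / 'C(deg v, deg_in F v)%:R).
Proof.
move=> FB; have := FB; rewrite inE => /andP [/forall_inP evF /forall_inP fullF].
rewrite big_V12 /=.
rewrite (eq_bigr (fun v => (-1) ^+ (deg_in F v)./2 *
      ('C(deg v, (deg v)./2)%:R *
        ('C((deg v)./2, (deg_in F v)./2)%:R / 'C(deg v, deg_in F v)%:R)))); last first.
  by move=> v vV1; rewrite /local_sum vV1 evF // mul1r.
(* The correction [2 ^+ (deg v == 0)] covers isolated vertices, where both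
   indicators of the local sum hold. *)
rewrite (eq_bigr (fun v => 2 ^+ deg v / 2 * 2 ^+ (deg v == 0%N))
          (P := fun v => v \in V2)); last first.
  move=> v vV2; have := vV2; rewrite in_V2 /local_sum => /negPf ->.
  rewrite -mulrA mulrC; congr (_ * _); have := fullF _ vV2.
  have [->|nz] := eqVneq (deg v) 0%N; first by rewrite orbb => ->.
  by case: eqVneq => [->|_ /= ->]; rewrite ?[0%N == _]eq_sym ?(negPf nz) ?addr0 ?add0r.
rewrite !big_split /= !prodrXr.
have -> : (\sum_(v in V2) (deg v == 0) = #|[set v in V2 | deg v == 0%N]|)%N.
  rewrite -sum1_card big_mkcond [RHS]big_mkcond /=; apply: eq_bigr => v _.
  by rewrite inE; case: (v \in V2); case: eqP.
set s := (\sum_(v in V1) _)%N.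
have sgn1 : (-1) ^+ #|F| * (-1) ^+ s = 1 :> rat.
  have [k ek] := dvdnP (four_dvd_sum_deg_in V2_comp FB).
  have : (#|F|.*2 = s.*2 + \sum_(v in V2) deg_in F v)%N.
    rewrite -sum_deg_in big_V12 /=; congr (_ + _)%N.
    rewrite -mul2n big_distrr; apply: eq_bigr => v vV1 /=.
    by rewrite mul2n even_halfK ?evF.
  rewrite ek => eF; have -> : #|F| = (s + 2 * k)%N by lia.
  by rewrite exprD mulrAC -expr2 sqrr_sign mul1r exprM sqrrN !expr1n.
by rewrite -[RHS]mul1r -[X in _ = X * _]sgn1; ring.
Qed.

(** The exact count, isolated vertices of [V2] included: each of them imposes no
    condition, although the prefactor charges 1/2 for it. *)
Lemma card_mixed :
  #|[set o : orientation G | mixed_Eulerian_even V1 V2 o]|%:R =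
  prefactor V1 V2 * edge_subset_sum V1 V2 * 2 ^+ #|[set v in V2 | deg v == 0%N]|.
Proof.
rewrite card_mixedE (bigID (mem (calB V1 V2))) /=.
rewrite [X in _ + X]big1 ?addr0 => [|F FnB]; last by rewrite prod_local_sum_eq0 ?mulr0.
rewrite prefactorE /edge_subset_sum -!mulrA; congr (_ * _).
rewrite mulr_suml !mulr_sumr; apply: eq_bigr => F FB.
by rewrite prod_local_sum //; ring.
Qed.

End Count.

(** * Positivity *)

Lemma prefactor_gt0 (G : graph) (V1 V2 : {set vertex G}) : 0 < prefactor V1 V2.
Proof.
rewrite mulr_gt0 ?exprz_gt0 // prodr_gt0 // => v _.
by rewrite divr_gt0 ?exprn_gt0 // ltr0n bin_gt0 -{2}[deg v]odd_double_half -addnn; lia.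
Qed.

(** The empty edge set contributes 1, and all terms are nonnegative. *)
Lemma edge_subset_sum_ge1 (G : graph) (V1 V2 : {set vertex G}) :
  1 <= edge_subset_sum V1 V2.
Proof.
have deg0 v : deg_in set0 v = 0%N by rewrite /deg_in big_set0.
have B0 : set0 \in calB V1 V2.
  by rewrite inE; apply/andP; split; apply/forall_inP => v _; rewrite deg0.
rewrite /edge_subset_sum (bigD1 set0) //= big1 => [|v _]; last first.
  by rewrite deg0 !bin0 divr1.
by rewrite lerDl sumr_ge0 // => F _; rewrite prodr_ge0 // => v _; rewrite divr_ge0.
Qed.

Theorem theorem4p5 (G : graph) (V1 V2 : {set vertex G})
    (V12_cover : V1 :|: V2 = [set: vertex G])
    (V12_disjoint : [disjoint V1 & V2])
    (V1_even : forall v, v \in V1 -> ~~ odd (deg v))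
    (V2_comp : forall C, C \in components V2 -> (4 %| \sum_(v in C) deg v)%N) :
  [/\ exists o : orientation G, mixed_Eulerian_even V1 V2 o,
      (forall v, v \in V2 -> (0 < deg v)%N) ->
        #|[set o : orientation G | mixed_Eulerian_even V1 V2 o]|%:R
          = prefactor V1 V2 * edge_subset_sum V1 V2,
      prefactor V1 V2 <= prefactor V1 V2 * edge_subset_sum V1 V2
    & prefactor V1 V2
        <= #|[set o : orientation G | mixed_Eulerian_even V1 V2 o]|%:R].
Proof.
have p0 := prefactor_gt0 V1 V2; have s1 := edge_subset_sum_ge1 V1 V2.
have le_ps : prefactor V1 V2 <= prefactor V1 V2 * edge_subset_sum V1 V2.
  by rewrite ler_peMr // ltW.
have cardE := card_mixed V12_cover V12_disjoint V1_even V2_comp.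
have le_pcard : prefactor V1 V2
    <= #|[set o : orientation G | mixed_Eulerian_even V1 V2 o]|%:R.
  rewrite cardE (le_trans le_ps) // ler_peMr ?exprn_ege1 ?ler1n //.
  exact: le_trans (ltW p0) le_ps.
split=> // [|deg_gt0].
  have := lt_le_trans p0 le_pcard; rewrite ltr0n => /card_gt0P [o].
  by rewrite inE; exists o.
rewrite cardE [X in _ ^+ X](_ : _ = 0%N) ?mulr1 //; apply/eqP.
rewrite cards_eq0; apply/eqP/setP => v; rewrite !inE; apply/negbTE.
by rewrite negb_and -implybE -lt0n; apply/implyP/deg_gt0.
Qed.
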